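(* Let $G$ be a graph belonging to $Cact(n;t)$ with $t\ge 3$. Let $C_h$ be a cycle with $h\ge 4$ vertices contained in $G$, and suppose that there is a unique vertex $u$ in $C_h$ which is adjacent to a vertex in $V(G)\setminus V(C_h)$. Let $v,w$ be vertices of $C_h$ with $uv, vw\in E(C_h)$ and $w\neq u$, and let $G^{*}=G-vw+uw$ be the graph obtained from $G$ by deleting the edge $vw$ and adding the edge $uw$. Then $D_R(G)>D_R(G^{*})$.
   Context: All graphs are finite and simple. A cactus is a connected graph in which every block is either an edge or a cycle. $Cact(n;t)$ is the set of connected cacti with $n$ vertices and exactly $t$ cycles. For a connected graph $G$, $R_G(u,v)$ is the resistance distance between $u$ and $v$, i.e. the effective resistance between $u$ and $v$ when every edge of $G$ is replaced by a unit resistor, and $d_G(u)$ is the degree of $u$. The degree resistance distance is $$D_R(G)=\sum_{\{u,v\}\subseteq V(G)}[d_G(u)+d_G(v)]\,R_G(u,v).$$ *)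

(* Defs.v *)
From HB Require Import structures.
From mathcomp Require Import all_boot all_order all_algebra.
From mathcomp Require Import boolp reals.
From mathcomp Require classical_sets.

Set Implicit Arguments.
Unset Strict Implicit.
Unset Printing Implicit Defensive.

Import Order.TTheory GRing.Theory Num.Theory.

(* The ambient graph is an adjacency relation on a finite vertex type.  Its
   subgraphs are pairs (vertex set, edge set), an edge being the set of its
   two ends. *)

Definition simple_graph (T : finType) (e : rel T) : Prop :=
  symmetric e /\ irreflexive e.

Notation subgraph T := ({set T} * {set {set T}})%type.

Section Subgraphs.
Variable T : finType.
Implicit Types (e : rel T) (H K : subgraph T) (c : seq T).

Definition vertices H : {set T} := H.1.
Definition edges H : {set {set T}} := H.2.

Definition whole e : subgraph T :=
  ([set: T], [set [set p.1; p.2] | p : T * T & e p.1 p.2]).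

Definition included H K : bool :=
  (vertices H \subset vertices K) && (edges H \subset edges K).

Definition subgraph_of e H : bool :=
  included H (whole e) && [forall f in edges H, f \subset vertices H].

Definition joined H : rel T :=
  connect (fun x y => [set x; y] \in edges H).

Definition connected H : Prop :=
  vertices H != set0 /\ {in vertices H &, forall x y, joined H x y}.

Definition delete_vertex H (z : T) : subgraph T :=
  ((vertices H :\ z), [set f in edges H | z \notin f]).

(* Deleting z separates two other vertices of the same component. *)
Definition cut_vertex H (z : T) : Prop :=
  z \in vertices H /\
  exists x y, [/\ x \in (vertices H :\ z), y \in (vertices H :\ z),
                  joined H x y & ~~ joined (delete_vertex H z) x y].

Definition nonseparable H : Prop :=
  connected H /\ forall z, ~ cut_vertex H z.

Definition block e H : Prop :=
  [/\ subgraph_of e H, nonseparable H &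
      forall K, subgraph_of e K -> nonseparable K -> included H K -> K = H].

Definition is_edge H : Prop :=
  exists x y : T, x != y /\ H = ([set x; y], [set [set x; y]]).

Definition is_cycle H : Prop :=
  exists c, [/\ uniq c, 3 <= size c &
    H = ([set x in c], [set [set x; next c x] | x in c])].

(* Cycles are counted as subgraphs, so without orientation or base point. *)
Definition cycles e : {set subgraph T} :=
  [set H | subgraph_of e H && `[< is_cycle H >]].

Definition cactus e : Prop :=
  connected (whole e) /\ forall H, block e H -> is_edge H \/ is_cycle H.

Definition Cact (n t : nat) e : Prop :=
  [/\ #|T| = n, cactus e & #|cycles e| = t].

(* The graph G - vw + uw. *)
Definition shift_edge e (u v w : T) : rel T := fun x y =>
  (e x y && ([set x; y] != [set v; w])) || ([set x; y] == [set u; w]).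

Definition degree e (x : T) : nat := #|[set y | e x y]|.

End Subgraphs.

Section Resistance.
Variables (R : realType) (T : finType).
Local Open Scope ring_scope.

(* Kirchhoff's and Ohm's laws with unit resistors: p is a vertex potential
   for which a unit current enters the network at u and leaves it at v. *)
Definition unit_current_potential (e : rel T) (u v : T) (p : {ffun T -> R})
    : Prop :=
  forall x, \sum_(y | e x y) (p x - p y) = (x == u)%:R - (x == v)%:R.

(* On a connected graph such a potential exists and is unique up to an
   additive constant, so the voltage drop does not depend on the choice. *)
Definition resistance (e : rel T) (u v : T) : R :=
  let p := classical_sets.xget [ffun=> 0] (unit_current_potential e u v) in
  p u - p v.

(* Ordering the vertices by enum_rank lists each unordered pair once. *)
Definition degree_resistance_distance (e : rel T) : R :=
  \sum_(x : T) \sum_(y : T | (enum_rank x < enum_rank y)%N)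
    (degree e x + degree e y)%:R * resistance e x y.

End Resistance.

Arguments degree_resistance_distance R {T} e.

(* Main.v *)
From HB Require Import structures.
Require Import Defs.
From mathcomp Require Import all_boot all_order all_algebra.
From mathcomp Require Import boolp reals ring lra zify.
From mathcomp Require classical_sets.

(** C hangs at u from the rest H of the graph.  Effective resistances add
    across the vertex u and those within H do not see C, so D_R splits into one
    contribution for each side of u.  On a cycle of length m the resistances
    from a vertex sum to (m^2 - 1) / 6, and in G* the side of C is a cycle of
    length k = h - 1 with a pendant vertex at u.  If M vertices lie outside C
    and H has q edges, this gives
      3 (D_R(G) - D_R(G* )) = k^2 - 6 k - 1 + M (2 k - 2) + q (2 k - 5),
    which for k >= 3 is positive as soon as M >= 3, or M >= 2 and q >= 3.  One
    of the two holds, since C has no chord and a second cycle must leave it. *)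

Set Implicit Arguments.
Unset Strict Implicit.
Unset Printing Implicit Defensive.

Import Order.TTheory GRing.Theory Num.Theory.

(** * Laplacian, unit-current potentials and effective resistance *)

Section Potentials.
Variables (R : realType) (T : finType).
Implicit Types (e : rel T) (p q : {ffun T -> R}) (S : {set T}).
Local Open Scope ring_scope.

Definition laplacian e p x : R := \sum_(y | e x y) (p x - p y).

(** Exchanging the two ends of every edge turns the sum into its own negative. *)
Lemma sum_laplacian e p : symmetric e -> \sum_x laplacian e p x = 0.
Proof.
move=> esym; pose s : R := \sum_x laplacian e p x.
have: s = - s; last by rewrite /s; lra.
rewrite {1}/s /laplacian (exchange_big_dep xpredT) //= -sumrN.
apply: eq_bigr => x _; rewrite -sumrN.
by apply: eq_big => [y|y _]; [rewrite esym | rewrite opprB].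
Qed.

(** Discrete Green identity. The left side is written once from each end of an edge and the two
    forms are added; the right side sees each edge twice, hence the factor 2. *)
Lemma laplacian_energy e p : symmetric e ->
  (\sum_x p x * laplacian e p x) *+ 2 =
  \sum_x \sum_(y | e x y) (p x - p y) ^+ 2.
Proof.
move=> esym.
have E1 : \sum_x p x * laplacian e p x =
    \sum_x \sum_(y | e x y) p x * (p x - p y).
  by apply: eq_bigr => x _; rewrite mulr_sumr.
have E2 : \sum_x p x * laplacian e p x =
    \sum_x \sum_(y | e x y) p y * (p y - p x).
  rewrite E1 (exchange_big_dep xpredT) //=; apply: eq_bigr => x _.
  by apply: eq_bigl => y; rewrite esym.
rewrite mulr2n {1}E1 E2 -big_split; apply: eq_bigr => x _.
by rewrite -big_split; apply: eq_bigr => y _ /=; ring.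
Qed.

(** A harmonic function has zero energy, so it takes equal values at the ends of each edge, and
    connectedness spreads this to all vertices. *)
Lemma harmonic_constant e p : symmetric e -> (forall x y, connect e x y) ->
  (forall x, laplacian e p x = 0) -> forall x y, p x = p y.
Proof.
move=> esym econn harm.
have E0 : \sum_x \sum_(y | e x y) (p x - p y) ^+ 2 = 0.
  by rewrite -laplacian_energy // big1 ?mul0rn // => x _; rewrite harm mulr0.
have edge x y : e x y -> p x = p y.
  move=> exy; have in0 x' : 0 <= \sum_(y | e x' y) (p x' - p y) ^+ 2.
    by apply: sumr_ge0 => *; apply: sqr_ge0.
  have E1 := psumr_eq0P (fun x' _ => in0 x') E0 (erefl : xpredT x).
  have /eqP := psumr_eq0P (fun y' _ => sqr_ge0 (p x - p y')) E1 exy.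
  by rewrite sqrf_eq0 subr_eq0 => /eqP.
move=> x y; have /connectP[s + ->] := econn x y.
by elim: s x => //= z s IH x /andP[/edge -> /IH].
Qed.

Lemma unit_current_potential_exists e u v : symmetric e ->
  (forall x y, connect e x y) ->
  exists p : {ffun T -> R}, unit_current_potential e u v p.
Proof.
move=> esym econn.
(* Adding the all-ones matrix makes the Laplacian of a connected graph
   invertible. *)
pose g p x : R := laplacian e p x + \sum_z p z.
pose delta i : {ffun T -> R} := [ffun z => (enum_rank z == i)%:R].
pose A := \matrix_(i < #|T|, j < #|T|) g (delta i) (enum_val j).
pose fn (a : 'rV[R]_#|T|) : {ffun T -> R} := [ffun z => a 0 (enum_rank z)].
have fnE (a : 'rV_#|T|) z : \sum_i a 0 i * delta i z = fn a z.
  rewrite ffunE (bigD1 (enum_rank z)) //= ffunE eqxx mulr1 big1 ?addr0 // => i.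
  by rewrite ffunE eq_sym => /negPf->; rewrite mulr0.
have AE (a : 'rV_#|T|) x : (a *m A) 0 (enum_rank x) = g (fn a) x.
  rewrite !mxE; under eq_bigr do rewrite mxE enum_rankK mulrDr !mulr_sumr.
  rewrite big_split /=; congr (_ + _); rewrite exchange_big /=.
    apply: eq_bigr => y _; under eq_bigr do rewrite mulrBr.
    by rewrite sumrB !fnE.
  by apply: eq_bigr => y _; rewrite fnE.
have T0 : #|T| != 0%N by apply/eqP => /card0_eq/(_ u); rewrite inE.
(* Summing [g p] over all vertices kills the Laplacian part and leaves the sum of [p] times the
   number of vertices. So a solution whose right-hand side has total 0 sums to 0 and solves the
   Laplace equation itself. *)
have mean0 p : \sum_x g p x = 0 -> \sum_x p x = 0.
  rewrite big_split /= sum_laplacian // add0r sumr_const => /eqP.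
  by rewrite mulrn_eq0 (negPf T0) => /eqP.
have freeA : row_free A.
  apply: inj_row_free => a aA0.
  have g0 x : g (fn a) x = 0 by rewrite -AE aA0 mxE.
  have s0 : \sum_z fn a z = 0 by apply: mean0; rewrite big1.
  have c0 : forall x y, fn a x = fn a y.
    by apply: harmonic_constant => // x; rewrite -(g0 x) /g s0 addr0.
  apply/rowP => i; rewrite mxE -(enum_valK i).
  have -> : a 0 (enum_rank (enum_val i)) = fn a (enum_val i) by rewrite ffunE.
  have/eqP := s0; rewrite (eq_bigr _ (fun z _ => c0 z (enum_val i))) sumr_const.
  by rewrite mulrn_eq0 (negPf T0) => /eqP.
pose b : 'rV[R]_#|T| :=
  \row_j ((enum_val j == u)%:R - (enum_val j == v)%:R).
have unitA : A \in unitmx by rewrite -row_free_unit.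
exists (fn (b *m invmx A)) => x; rewrite -/(laplacian _ _ _).
have gb y : g (fn (b *m invmx A)) y = (y == u)%:R - (y == v)%:R.
  by rewrite -AE mulmxKV // mxE enum_rankK.
rewrite -gb /g [X in _ + X]mean0 ?addr0 //; under eq_bigr do rewrite gb.
rewrite sumrB (bigD1 u) //= [X in _ - X](bigD1 v) //= !eqxx !big1 ?subrr //.
  by move=> y /negPf->.
by move=> y /negPf->.
Qed.

(** The potential chosen by [xget] and [p] differ by a harmonic, hence constant, function; any
    explicit potential may therefore be used to compute a resistance. *)
Lemma resistanceE e u v p : symmetric e -> (forall x y, connect e x y) ->
  unit_current_potential e u v p -> resistance R e u v = p u - p v.
Proof.
move=> esym econn pP; rewrite /resistance; set q := classical_sets.xget _ _.
have qP : unit_current_potential e u v q by exact: classical_sets.xgetI pP.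
have c0 : forall x y, [ffun z => p z - q z] x = [ffun z => p z - q z] y.
  apply: harmonic_constant esym econn _ => x.
  rewrite -[RHS](subrr ((x == u)%:R - (x == v)%:R)) -{1}pP -qP -sumrB.
  by apply: eq_bigr => y _; rewrite !ffunE; ring.
by have := c0 u v; rewrite !ffunE; lra.
Qed.

Lemma resistancexx e u : resistance R e u u = 0.
Proof. by rewrite /resistance subrr. Qed.

Lemma resistance_sym e u v : symmetric e -> (forall x y, connect e x y) ->
  resistance R e u v = resistance R e v u.
Proof.
move=> esym econn; have [p pP] := unit_current_potential_exists u v esym econn.
rewrite (resistanceE esym econn pP).
rewrite (@resistanceE _ _ _ [ffun z => - p z]) //; first by rewrite !ffunE; lra.
move=> x; rewrite -[RHS]opprB -pP -sumrN.
by apply: eq_bigr => y _; rewrite !ffunE; lra.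
Qed.

(** All the current runs through the only edge at [v], so the indicator of [v] is a potential. *)
Lemma resistance_adjacent_leaf e u v : symmetric e ->
  (forall x y, connect e x y) -> e v =1 pred1 u -> u != v ->
  resistance R e v u = 1.
Proof.
move=> esym econn ev uv.
rewrite (@resistanceE _ _ _ [ffun z => (z == v)%:R]) //.
  by rewrite !ffunE eqxx (negPf uv) subr0.
move=> x; have [->|xv] := eqVneq x v.
  by rewrite (eq_bigl _ _ ev) big_pred1_eq !ffunE eqxx (negPf uv) eq_sym
     (negPf uv).
under eq_bigr do rewrite !ffunE (negPf xv) sub0r.
rewrite sub0r big_mkcond (bigD1 v) //= esym ev eqxx /= big1 ?addr0.
  by case: eqP; rewrite ?oppr0.
by move=> y /negPf->; rewrite oppr0; case: ifP.
Qed.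

End Potentials.

(** * Resistances when a vertex set is attached at a single vertex *)

Section Attachment.
Variable T : finType.
Implicit Types (e : rel T) (S : {set T}).

Definition induced e S : rel T := [rel x y | [&& e x y, x \in S & y \in S]].

Definition attached_at e S (u : T) : Prop :=
  u \in S /\ forall x y, x \in S -> y \notin S -> e x y -> x = u.

(** Keeping [u] on both sides makes each edge of a simple graph lie within exactly one side when [S]
    is attached at [u]. *)
Definition far_side S (u : T) : {set T} := u |: ~: S.

Lemma attached_far_side e S u : symmetric e -> attached_at e S u ->
  attached_at e (far_side S u) u.
Proof.
move=> esym [uS cut]; split=> [|x y]; first by rewrite !inE eqxx.
rewrite !inE negb_or negbK => /orP[/eqP->//|xS] /andP[yu yS] exy.
by rewrite esym in exy; rewrite (cut y x yS xS exy) eqxx in yu.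
Qed.

Section Localization.
Variables (R : realType) (S : {set T}) (u : T).
Implicit Types p q : {ffun T -> R}.
Local Open Scope ring_scope.

(** Freezing the potential at its value at [u] ensures that no current flows outside [S]. *)
Definition const_outside p : {ffun T -> R} :=
  [ffun z => if z \in S then p z else p u].

(** A vertex of [S] other than [u] has all its neighbours in [S], so Kirchhoff's law is inherited
    there. At [u] it follows because both the Laplacian and the prescribed currents sum to 0. *)
Lemma potential_induced e x y p : symmetric e -> attached_at e S u ->
  x \in S -> y \in S -> unit_current_potential e x y p ->
  unit_current_potential (induced e S) x y p.
Proof.
move=> esym [uS cut] xS yS pP.
have off z : z != u ->
    laplacian (induced e S) p z = (z == x)%:R - (z == y)%:R :> R.
  move=> zu; have [zS|zS] := boolP (z \in S); last first.
    rewrite /laplacian big1 => [|t]; last first.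
      by rewrite /induced /= (negPf zS) andbF.
    by case: eqP zS => [->|_]; [rewrite xS | case: eqP => [->|_];
       rewrite ?yS ?subrr].
  rewrite -pP; apply: eq_bigl => t; rewrite /induced /= zS /=.
  have [tS|tS] := boolP (t \in S); first by rewrite andbT.
  by rewrite andbF; symmetry; apply: contraNF zu => /(cut _ _ zS tS)->.
have isym : symmetric (induced e S).
  by move=> a b; rewrite /induced /= esym; congr andb; apply: andbC.
move=> z; rewrite -/(laplacian _ _ _); have [->|/off//] := eqVneq z u.
have s0 := sum_laplacian p isym; rewrite (bigD1 u) //= in s0.
rewrite (eq_bigr _ off) in s0.
have s1 : \sum_z ((z == x)%:R - (z == y)%:R) = 0 :> R.
  rewrite sumrB (bigD1 x) //= [X in _ - X](bigD1 y) //= !eqxx !big1 ?subrr //.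
    by move=> t /negPf->.
  by move=> t /negPf->.
by rewrite (bigD1 u) //= in s1; lra.
Qed.

Lemma potential_const_outside e x y p : symmetric e -> attached_at e S u ->
  x \in S -> y \in S -> unit_current_potential (induced e S) x y p ->
  unit_current_potential e x y (const_outside p).
Proof.
move=> esym [uS cut] xS yS pP z; rewrite -pP.
have [zS|zS] := boolP (z \in S); last first.
  rewrite [RHS]big1 => [|t]; last by rewrite /induced /= (negPf zS) andbF.
  rewrite big1 // => t; rewrite !ffunE (negPf zS) esym => etz.
  by case: ifP => [tS|_]; rewrite ?subrr // (cut _ _ tS zS etz) subrr.
rewrite (bigID (mem S)) /= [X in _ + X]big1 ?addr0.
  by apply: eq_big => [t|t /andP[_ tS]]; rewrite /induced /= ?zS //
    !ffunE zS tS.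
move=> t /andP[ezt tS].
by rewrite !ffunE zS (negPf tS) (cut _ _ zS tS ezt) subrr.
Qed.

Lemma resistance_induced e x y p : symmetric e ->
  (forall x y, connect e x y) -> attached_at e S u -> x \in S -> y \in S ->
  unit_current_potential (induced e S) x y p -> resistance R e x y = p x - p y.
Proof.
move=> esym econn cut xS yS /(potential_const_outside esym cut xS yS) pP.
by rewrite (resistanceE esym econn pP) !ffunE xS yS.
Qed.

(** A potential for [e] restricts to [S], where the two graphs agree, and the restriction extends to
    a potential for [e']. *)
Lemma eq_resistance_induced e e' x y : symmetric e -> symmetric e' ->
  (forall x y, connect e x y) -> (forall x y, connect e' x y) ->
  attached_at e S u -> attached_at e' S u ->
  {in S &, e =2 e'} -> x \in S -> y \in S ->
  resistance R e x y = resistance R e' x y.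
Proof.
move=> esym e'sym econn e'conn cut cut' ee' xS yS.
have [p pP] := unit_current_potential_exists R x y esym econn.
have pi := potential_induced esym cut xS yS pP.
rewrite (resistanceE esym econn pP).
rewrite (resistance_induced e'sym e'conn cut' xS yS (p := p)) // => z.
rewrite -pi; apply: eq_bigl => t; rewrite /induced /=.
by have [zS|] := boolP (z \in S); have [tS|] := boolP (t \in S);
   rewrite ?andbF // ee'.
Qed.

End Localization.

(** Series law. A current from [x] to [u] confined to [S] is superposed on one from [u] to [y]
    confined to the far side; each potential is constant on the side of the other. *)
Lemma resistance_across (R : realType) e S u x y : symmetric e ->
  (forall x y, connect e x y) -> attached_at e S u ->
  x \in S -> y \notin S ->
  (resistance R e x y = resistance R e x u + resistance R e u y)%R.
Proof.
move=> esym econn cut xS yS; have [uS _] := cut.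
have cut' := attached_far_side esym cut.
have uS' := cut'.1; have yS' : y \in far_side S u by rewrite !inE yS orbT.
have [p pP] := unit_current_potential_exists R x u esym econn.
have [q qP] := unit_current_potential_exists R u y esym econn.
have pP' := potential_const_outside esym cut xS uS
  (potential_induced esym cut xS uS pP).
have qP' := potential_const_outside esym cut' uS' yS'
  (potential_induced esym cut' uS' yS' qP).
rewrite (resistanceE esym econn pP) (resistanceE esym econn qP).
rewrite (@resistanceE _ _ _ _ _
  [ffun z => (const_outside S u p z + const_outside (far_side S u) u q z)%R])//.
  rewrite !ffunE xS yS' (negPf yS) !inE xS orbF.
  by case: eqP => [->|_]; lra.
move=> z; transitivity ((z == x)%:R - (z == u)%:R +
  ((z == u)%:R - (z == y)%:R) : R)%R; last by ring.
rewrite -pP' -qP' -big_split; apply: eq_bigr => t _.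
by rewrite [in LHS]ffunE [X in (_ - X)%R]ffunE /=; ring.
Qed.

End Attachment.

(** * Splitting D_R at the attaching vertex *)

Section Gluing.
Variables (R : realType) (T : finType).
Implicit Types (e : rel T) (S : {set T}).
Local Open Scope ring_scope.

Definition degree_in e S x : nat := #|[set y in S | e x y]|.

(** The two degrees in the term of a pair are separated, one for each ordering of the pair; the
    diagonal adds nothing. *)
Lemma degree_resistance_distanceE e : symmetric e ->
  (forall x y, connect e x y) ->
  degree_resistance_distance R e =
  \sum_x (degree e x)%:R * \sum_y resistance R e x y.
Proof.
move=> esym econn; rewrite /degree_resistance_distance.
have -> : \sum_x \sum_(y | (enum_rank x < enum_rank y)%N)
      (degree e x + degree e y)%:R * resistance R e x y =
    \sum_x \sum_(y | (enum_rank x < enum_rank y)%N)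
      (degree e x)%:R * resistance R e x y +
    \sum_x \sum_(y | (enum_rank x < enum_rank y)%N)
      (degree e y)%:R * resistance R e x y.
  rewrite -big_split; apply: eq_bigr => x _; rewrite -big_split.
  by apply: eq_bigr => y _; rewrite natrD mulrDl.
rewrite [X in _ + X](exchange_big_dep xpredT) //= -big_split.
apply: eq_bigr => x _ /=; rewrite [in RHS](bigD1 x) //= resistancexx add0r.
rewrite mulr_sumr [RHS](bigID (fun y => (enum_rank x < enum_rank y)%N)) /=.
congr (_ + _); apply: eq_big => y; rewrite ?(resistance_sym R y x) //.
  by have [->|] := eqVneq y x; rewrite ?ltnn.
have [->|yx] := eqVneq y x; rewrite ?ltnn //= -leqNgt ltn_neqAle.
by rewrite (inj_eq val_inj) (inj_eq enum_rank_inj) yx.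
Qed.

(** The neighbours of a vertex other than [u] all lie on its own side. Those of [u] are divided
    between the two sides without overlap, since only [u] is common to both and it is not its own
    neighbour. *)
Lemma degree_split e S u x : symmetric e -> irreflexive e ->
  attached_at e S u ->
  degree e x = ((x \in S) * degree_in e S x +
    (x \in far_side S u) * degree_in e (far_side S u) x)%N.
Proof.
move=> esym eirr [uS cut]; rewrite /degree /degree_in.
have [->|xu] := eqVneq x u.
  rewrite uS !inE eqxx !mul1n -cardsUI -[LHS]addn0; congr addn.
    apply: eq_card => y; rewrite !inE; case: (y \in S); rewrite ?orbT //=.
      by case: (y == u); rewrite ?orbF ?orbb.
  symmetry; apply/eqP; rewrite cards_eq0; apply/eqP/setP => y; rewrite !inE.
  have [->|] := eqVneq y u; first by rewrite eirr !andbF.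
  by case: (y \in S); rewrite ?andbF.
rewrite !inE (negPf xu) /=; have [xS|xS] := boolP (x \in S).
  rewrite mul1n mul0n addn0; apply: eq_card => y; rewrite !inE.
  by have [//|yS] := boolP (y \in S); apply: contraNF xu => /(cut _ _ xS yS)->.
rewrite mul0n mul1n; apply: eq_card => y; rewrite !inE.
have [yS|yS] := boolP (y \in S); last by rewrite orbT.
rewrite orbF; have [//|yu] := eqVneq y u; rewrite esym.
by apply: contraNF yu => /(cut _ _ yS xS)->.
Qed.

(** The part of D_R weighted by degrees within [S]. By the series law a vertex y off [S] is at
    resistance R(u,x) + R(u,y) from x, which yields the last two terms. *)
Definition side_contribution e S u : R :=
  \sum_(x in S) (degree_in e S x)%:R * \sum_(y in S) resistance R e x y +
  #|~: S|%:R * (\sum_(x in S) (degree_in e S x)%:R * resistance R e u x) +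
  (\sum_(x in S) (degree_in e S x)%:R) * \sum_(y in ~: S) resistance R e u y.

Lemma side_contributionE e S u : symmetric e -> (forall x y, connect e x y) ->
  attached_at e S u ->
  \sum_(x in S) (degree_in e S x)%:R * \sum_y resistance R e x y =
  side_contribution e S u.
Proof.
move=> esym econn cut; rewrite /side_contribution mulr_sumr mulr_suml.
rewrite -!big_split; apply: eq_bigr => x xS /=.
rewrite (bigID (mem S)) /= -addrA mulrDr; congr (_ + _).
have -> : \sum_(y | y \notin S) resistance R e x y =
    \sum_(y in ~: S) (resistance R e u x + resistance R e u y).
  apply: eq_big => y; first by rewrite inE.
  by move=> yS; rewrite (resistance_across R esym econn cut xS yS)
     (resistance_sym R x u).
by rewrite big_split /= sumr_const -mulr_natl; ring.
Qed.

Lemma degree_resistance_distance_glue e S u : symmetric e -> irreflexive e ->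
  (forall x y, connect e x y) -> attached_at e S u ->
  degree_resistance_distance R e =
  side_contribution e S u + side_contribution e (far_side S u) u.
Proof.
move=> esym eirr econn cut; rewrite degree_resistance_distanceE //.
have cut' := attached_far_side esym cut.
rewrite -!side_contributionE // [X in X + _]big_mkcond [X in _ + X]big_mkcond.
rewrite -big_split; apply: eq_bigr => x _ /=.
rewrite (degree_split x esym eirr cut) natrD mulrDl.
by congr (_ + _); case: ifP; rewrite ?mul1n // mul0n mul0r.
Qed.

End Gluing.

(** * Cycles as duplicate-free sequences *)

Section CyclicSequences.
Variable T : finType.
Implicit Types (c : seq T) (e : rel T).

Lemma index_next c x : uniq c -> x \in c ->
  index (next c x) c =
  if (index x c).+1 == size c then 0 else (index x c).+1.
Proof.
move=> Uc xc; rewrite next_nth xc; case: c Uc xc => // y s Uc xc.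
have := xc; rewrite -index_mem [size _]/= ltnS leq_eqVlt.
(* For the last vertex the lookup runs off [s], and its default, the head [y], closes the cycle. *)
case/orP=> [/eqP ixs|ixs].
  by rewrite ixs nth_default // [size _]/= !eqxx /= eqxx.
rewrite [size _]/= eqSS (ltn_eqF ixs).
rewrite -[nth _ _ _]/(nth y (y :: s) (index x (y :: s)).+1) index_uniq //.
Qed.

Lemma index_prev c x : uniq c -> x \in c ->
  index (prev c x) c =
  if index x c == 0 then (size c).-1 else (index x c).-1.
Proof.
move=> Uc xc; have pc : prev c x \in c by rewrite mem_prev.
have := index_next Uc pc; rewrite next_prev // => ->.
by move: pc; rewrite -index_mem; case: (_.+1 =P _) => // <-.
Qed.

Lemma next_neq_prev c x : uniq c -> 2 < size c -> x \in c ->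
  next c x != prev c x.
Proof.
move=> Uc c3 xc; apply: contraTneq c3 => np.
have := index_next Uc xc; have := index_prev Uc xc; rewrite np => -> .
by move: xc; rewrite -index_mem; case: eqP; case: eqP; lia.
Qed.

(** Being an equality, this makes the cycle induced: chords are ruled out as well. *)
Definition cyclic_on e c : Prop :=
  {in c &, forall x y, e x y = (y \in [:: next c x; prev c x])}.

Lemma cyclic_on_rot e c i : uniq c -> cyclic_on e c -> cyclic_on e (rot i c).
Proof.
by move=> Uc cyc x y; rewrite !mem_rot next_rot // prev_rot //; apply: cyc.
Qed.

Lemma cyclic_on_rev e c : uniq c -> cyclic_on e c -> cyclic_on e (rev c).
Proof.
move=> Uc cyc x y; rewrite !mem_rev next_rev // prev_rev // => xc yc.
by rewrite cyc // !inE orbC.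
Qed.

Lemma cyclic_on_set e c x : cyclic_on e c -> x \in c ->
  [set y in [set z in c] | e x y] = [set next c x; prev c x].
Proof.
move=> cyc xc; apply/setP => y; rewrite !inE.
have [yc|] /= := boolP (y \in c); first by rewrite cyc // !inE.
by move=> yc; symmetry; apply: contraNF yc => /orP[]/eqP->;
   rewrite ?mem_next ?mem_prev.
Qed.

Lemma degree_in_cyclic e c x : uniq c -> 2 < size c -> cyclic_on e c ->
  x \in c -> degree_in e [set z in c] x = 2.
Proof.
move=> Uc c3 cyc xc; rewrite /degree_in (cyclic_on_set cyc xc).
by rewrite cards2 next_neq_prev.
Qed.

End CyclicSequences.

(** * Resistances on a cycle *)

Section CycleResistance.
Variables (R : realType) (T : finType) (e : rel T) (u : T) (c : seq T).
Local Open Scope ring_scope.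
Hypotheses (esym : symmetric e) (econn : forall x y, connect e x y).
Hypotheses (Uc : uniq c) (c3 : (2 < size c)%N).
Hypotheses (cyc : cyclic_on e c) (att : attached_at e [set z in c] u).

(* With k vertices, current entering at index 0 and leaving at index j, the
   potential at index m is m j / k - min(m, j). *)
Lemma resistance_cycle_head x s j : c = x :: s -> (j < size c)%N ->
  resistance R e x (nth x c j) = j%:R - j%:R ^+ 2 / (size c)%:R.
Proof.
move=> cE jc; set k := size c.
have k0 : k%:R != 0 :> R by rewrite pnatr_eq0; lia.
pose g m : R := m%:R * j%:R / k%:R - (minn m j)%:R.
have yc : nth x c j \in c by rewrite mem_nth.
have xc : x \in c by rewrite cE mem_head.
have ix : index x c = 0%N by rewrite cE /= eqxx.
have iy : index (nth x c j) c = j by rewrite index_uniq.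
pose p : {ffun T -> R} := [ffun z => g (index z c)].
rewrite (@resistance_induced _ R [set z in c] u e _ _ p) ?inE //.
  by rewrite !ffunE ix iy /g minnn min0n; field.
move=> z; have [zc|zc] := boolP (z \in c); last first.
  rewrite big1; last by move=> t; rewrite /induced /= !inE (negPf zc) andbF.
  have [zx|_] := eqVneq z x; first by rewrite zx xc in zc.
  have [zy|_] := eqVneq z _; first by rewrite zy yc in zc.
  by rewrite subrr.
have -> : \sum_(t | induced e [set z0 in c] z t) (p z - p t) =
    \sum_(t in [set next c z; prev c z]) (p z - p t).
  apply: eq_bigl => t; rewrite -(cyclic_on_set cyc zc) /induced /= !inE zc /=.
  exact: andbC.
rewrite big_setU1 ?inE ?next_neq_prev // big_set1 /= !ffunE.
rewrite index_next // index_prev //.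
have izc : (index z c < k)%N by rewrite index_mem.
have -> : (z == x) = (index z c == 0%N).
  rewrite -ix; apply/eqP/eqP => [->//|].
  by move/(congr1 (nth x c)); rewrite !nth_index.
have -> : (z == nth x c j) = (index z c == j).
  by apply/eqP/eqP => [->//|<-]; rewrite nth_index.
rewrite -/k; move: (index z c) izc => i ik.
(* The formula gives the same value 0 at m = k as at m = 0, so the wrap after the last index needs
   no case of its own. *)
have -> : g (if i.+1 == k then 0%N else i.+1) = g i.+1.
  case: eqP => // ->; rewrite /g min0n (minn_idPr (ltnW jc)); field.
  exact: k0.
have g0 : g k = 0 by rewrite /g (minn_idPr (ltnW jc)); field.
(* At index 0 the predecessor is k - 1, where the minimum with [j] is still [j]. *)
have [->|i0] := eqVneq i 0%N.
  have -> : g k.-1 = j%:R * (k%:R - 1) / k%:R - j%:R.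
    rewrite /g; have -> : minn k.-1 j = j by lia.
    have -> : k.-1%:R = k%:R - 1 :> R.
      by apply/eqP; rewrite eq_sym subr_eq natr1; apply/eqP; congr _%:R; lia.
    by ring.
  rewrite /g min0n eq_sym; case: (j) => [|j'] /=.
    by rewrite minn0; field.
  have -> : minn 1 j'.+1 = 1%N by lia.
  by field.
(* Elsewhere the linear part of [g] has zero second difference, and only the kink of the minimum at
   [j] draws current. *)
case: i i0 ik => // i _ ik /=; rewrite /g -[i.+2]addn2 -[i.+1]addn1 !natrD.
have [<-|ij] := eqVneq (i + 1)%N j.
  have -> : minn (i + 2) (i + 1) = (i + 1)%N by lia.
  have -> : minn i (i + 1) = i by lia.
  by rewrite minnn !natrD /=; field.
have [ltij|leji] := ltnP i j.
  have -> : minn (i + 2) j = (i + 2)%N by lia.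
  have -> : minn (i + 1) j = (i + 1)%N by lia.
  by rewrite !natrD /=; field.
have -> : minn (i + 2) j = j by lia.
have -> : minn (i + 1) j = j by lia.
by rewrite /=; field.
Qed.
End CycleResistance.

Lemma sum_cycle_resistances (R : realType) (k : nat) : 0 < k ->
  (\sum_(0 <= j < k) (j%:R - j%:R ^+ 2 / k%:R) = (k%:R ^+ 2 - 1) / 6%:R :> R)%R.
Proof.
move=> k0; rewrite sumrB -mulr_suml.
have -> m : (\sum_(0 <= j < m) j%:R = m%:R * (m%:R - 1) / 2%:R :> R)%R.
  elim: m => [|m IH]; first by rewrite big_geq // !mul0r.
  by rewrite big_nat_recr //= IH -natr1; field.
have -> m : (\sum_(0 <= j < m) j%:R ^+ 2 =
    m%:R * (m%:R - 1) * (2%:R * m%:R - 1) / 6%:R :> R)%R.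
  elim: m => [|m IH]; first by rewrite big_geq // !mul0r.
  by rewrite big_nat_recr //= IH -natr1; field.
by field; rewrite pnatr_eq0; lia.
Qed.

(** Rotating the cycle brings [x] to the head, from where the resistance to each vertex is a
    function of its index. *)
Lemma cycle_resistance_sum (R : realType) (T : finType) (e : rel T)
    (u : T) (c : seq T) (x : T) :
  symmetric e -> (forall x y, connect e x y) -> uniq c -> 2 < size c ->
  cyclic_on e c -> attached_at e [set z in c] u -> x \in c ->
  (\sum_(y in [set z in c]) resistance R e x y =
   ((size c)%:R ^+ 2 - 1) / 6%:R)%R.
Proof.
move=> esym econn Uc c3 cyc att /rot_to[i s cE].
have Ur : uniq (rot i c) by rewrite rot_uniq.
have sr : size (rot i c) = size c by rewrite size_rot.
have cycr := cyclic_on_rot (i := i) Uc cyc.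
have Er : [set z in rot i c] = [set z in c].
  by apply/setP => z; rewrite !inE mem_rot.
rewrite -Er in att *; rewrite -sr in c3 *.
rewrite (eq_bigl (mem (rot i c))); last by move=> y; rewrite inE.
rewrite -big_uniq //= (big_nth x) -sum_cycle_resistances; last by lia.
rewrite !big_nat; apply: eq_bigr => j /= jc.

exact: (resistance_cycle_head R esym econn Ur c3 cycr att cE jc).
Qed.

(** * Cycles, blocks and chords in a cactus *)

Section Cacti.
Variable T : finType.
Implicit Types (e : rel T) (c : seq T) (H K : subgraph T) (x y z : T).

Lemma set2_inj x y a b :
  [set x; y] = [set a; b] -> x = a /\ y = b \/ x = b /\ y = a.
Proof.
move=> /setP E; have := E x; have := E y; have := E a; have := E b.
rewrite !inE !eqxx !orbT /=.
by move=> /orP[]/eqP ? /orP[]/eqP ? /esym/orP[]/eqP ? /esym/orP[]/eqP ?;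
  subst; auto.
Qed.

Lemma whole_edge e x y : symmetric e ->
  ([set x; y] \in edges (whole e)) = e x y.
Proof.
move=> esym; apply/imsetP/idP => [[[a b]] /= |exy].
  by rewrite inE /= => eab /set2_inj[] [-> ->] //; rewrite esym.
by exists (x, y) => //; rewrite inE.
Qed.

Definition cycle_graph c : subgraph T :=
  ([set x in c], [set [set x; next c x] | x in c]).

Lemma cycle_graph_edge c x y : uniq c -> x \in c ->
  ([set x; y] \in edges (cycle_graph c)) = (y \in [:: next c x; prev c x]).
Proof.
move=> Uc xc; apply/imsetP/idP => [[z zc /set2_inj[] [-> ->]]|].
- by rewrite !inE eqxx.
- by rewrite !inE prev_next // eqxx orbT.
rewrite !inE => /orP[]/eqP->; first by exists x.
by exists (prev c x); rewrite ?mem_prev // next_prev // setUC.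
Qed.

Lemma card_cycle_graph c : uniq c -> #|vertices (cycle_graph c)| = size c.
Proof. by move=> Uc; rewrite cardsE; apply/card_uniqP. Qed.

(** A cycle minus a vertex is a path. The base point is the successor of [z], or the head of [c]
    when [z] is not on the cycle; the rest is reached by following [next]. *)
Lemma cycle_delete_joined c z : uniq c ->
  {in vertices (cycle_graph c) :\ z &, forall x y,
    joined (delete_vertex (cycle_graph c) z) x y}.
Proof.
move=> Uc; set r := fun x y => [set x; y] \in
  edges (delete_vertex (cycle_graph c) z).
have rsym : connect_sym r by apply: sym_connect_sym => x y; rewrite /r setUC.
suff [b Pb] : exists b, forall x, x \in c -> x != z -> connect r b x.
  move=> x y; rewrite !inE => /andP[xz xc] /andP[yz yc].
  by apply: (connect_trans (y := b)); rewrite -?/r ?Pb // rsym Pb.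
have rnext x : x \in c -> x != z -> next c x != z -> r x (next c x).
  move=> xc xz nz; rewrite /r inE !inE negb_or eq_sym xz eq_sym nz !andbT.
  by apply/imsetP; exists x.
have path_next b s : path (frel (next c)) b s -> {subset b :: s <= c} ->
    z \notin b :: s -> path r b s.
  elim: s b => //= y s IH b /andP[/eqP <- ps] sub.
  rewrite inE negb_or => /andP[zb zs]; rewrite IH //; last first.
    by move=> t ts; apply: sub; rewrite inE ts orbT.
  rewrite rnext ?sub ?mem_head // eq_sym //.
  by move: zs; rewrite inE negb_or => /andP[].
have [zc|zc] := boolP (z \in c); last first.
  case: c Uc zc @r rsym rnext path_next => [|b s] Uc zc r rsym rnext path_next.
    by exists z.
  exists b => x xc _; apply: (path_connect (p := s)); rewrite ?path_next //.
  by have := cycle_next Uc; rewrite /= rcons_path => /andP[].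
have [i s E] := rot_to zc.
have := cycle_next Uc; rewrite -(rot_cycle i) E => cs.
have Us : uniq (z :: s) by rewrite -E rot_uniq.
have memE x : (x \in c) = (x \in z :: s) by rewrite -E mem_rot.
case: s E cs Us memE => [|b s] E cs Us memE.
  by exists z => x; rewrite memE inE => ->.
exists b => x; rewrite memE inE => /orP[->//|xs] _.
apply: (path_connect (p := s)) => //; apply: path_next.
- by move: cs => /= /andP[_]; rewrite rcons_path => /andP[].
- by move=> t ts; rewrite memE inE ts orbT.
- by case/andP: Us.
Qed.

(** Extra edges cannot disconnect the path left by deleting a vertex. The statement is meant for a
    cycle with a chord added. *)
Lemma supergraph_nonseparable c H : uniq c -> 2 < size c ->
  vertices H = vertices (cycle_graph c) ->
  edges (cycle_graph c) \subset edges H -> nonseparable H.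
Proof.
move=> Uc c3 VE /subsetP EE.
have del z x y : x \in vertices H :\ z -> y \in vertices H :\ z ->
    joined (delete_vertex H z) x y.
  rewrite VE => xV yV; have := cycle_delete_joined Uc xV yV.
  apply: connect_sub => a b; rewrite inE => /andP[/EE ab zab].
  by apply: connect1; rewrite inE ab.
split; last by move=> z [_ [x [y [xV yV _ /negP]]]]; apply; apply: del.
split; first by rewrite -card_gt0 VE card_cycle_graph //; lia.
move=> x y xV yV.
(* Connectedness of [H] itself comes from deleting a third vertex, which already leaves [x] and [y]
   joined. *)
have /set0Pn[z] : vertices H :\: [set x; y] != set0.
  rewrite -card_gt0 cardsD VE card_cycle_graph // subn_gt0.
  apply: leq_ltn_trans c3; apply: leq_trans (subset_leq_card (subsetIr _ _)) _.
  by rewrite cards2; case: (_ != _).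
rewrite !inE negb_or => /andP[/andP[zx zy] zV].
have := del z x y; rewrite !inE -/(vertices H) ![_ == z]eq_sym zx zy xV yV.
move=> /(_ isT isT); apply: connect_sub => a b; rewrite inE => /andP[ab _].
exact: connect1.
Qed.

(** Among nonseparable subgraphs containing [H], one with the most vertices and edges together is a
    block, as a larger one would have the same counts and hence be equal. *)
Lemma block_above e H : subgraph_of e H -> nonseparable H ->
  exists2 K, block e K & included H K.
Proof.
move=> eH nH.
pose P K := `[< [/\ subgraph_of e K, nonseparable K & included H K] >].
have PH : P H by apply/asboolP; split; rewrite // /included !subxx.
pose f K := #|vertices K| + #|edges K|.
case: (@arg_maxnP _ H P f PH) => K /asboolP[eK nK HK] maxK.
exists K => //; split=> // K' eK' nK' KK'.
case/andP: (KK') => V1 E1; case/andP: HK => V0 E0.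
have /maxK : P K'.
  by apply/asboolP; split=> //; apply/andP; split; [apply: subset_trans V1|
     apply: subset_trans E1].
rewrite /f => le; have cV := subset_leq_card V1; have cE := subset_leq_card E1.
have VK : vertices K = vertices K' by apply/eqP; rewrite eqEcard V1; lia.
have EK : edges K = edges K' by apply/eqP; rewrite eqEcard E1; lia.
by case: K K' VK EK {maxK eK nK eK' nK' KK' V1 E1 V0 E0 le cV cE} =>
  [? ?] [? ?] /= -> ->.
Qed.

(* A chord xy would put C + xy inside one block, in which x has three
   neighbours. *)
Lemma cactus_cyclic_on e c : simple_graph e -> cactus e -> uniq c ->
  2 < size c -> subgraph_of e (cycle_graph c) -> cyclic_on e c.
Proof.
move=> [esym eirr] [_ cact] Uc c3 ec x y xc yc.
have /andP[/andP[_ /subsetP sE] _] := ec.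
have edge a b : a \in c -> b \in [:: next c a; prev c a] -> e a b.
  by move=> ac; rewrite -cycle_graph_edge // => /sE; rewrite whole_edge.
apply/idP/idP => [exy|]; last exact: edge.
pose H : subgraph T := (vertices (cycle_graph c),
  edges (cycle_graph c) :|: [set [set x; y]]).
have eH : subgraph_of e H.
  case/andP: ec => /andP[sV sE'] /forallP vE; apply/andP; split.
    apply/andP; split=> //; apply/subsetP => f; rewrite !inE.
    by case/orP => [/sE//|/eqP->]; rewrite -/(edges (whole e)) whole_edge.
  apply/forallP => f; apply/implyP; rewrite /edges /= in_setU in_set1.
  case/orP => [fE|/eqP->]; first by have /implyP/(_ fE) := vE f.
  by apply/subsetP => t; rewrite !inE => /orP[]/eqP->.
have nH : nonseparable H by apply: supergraph_nonseparable Uc c3 _ _ => //;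
  apply: subsetUl.
have [K bK /andP[/subsetP VK /subsetP EK]] := block_above eH nH.
have cK a : a \in c -> a \in vertices K by move=> ac; apply: VK; rewrite inE.
have nK a : a \in [:: next c x; prev c x; y] -> [set x; a] \in edges K.
  move=> aE; have {aE} : (a \in [:: next c x; prev c x]) || (a == y).
    by move: aE; rewrite !inE orbA.
  rewrite -cycle_graph_edge // => aE; apply: EK.
  rewrite /edges /= in_setU in_set1.
  by case/orP: aE => [->//|/eqP->]; rewrite eqxx orbT.
case: (cact K bK) => [[a [b [_ KE]]]|[c' [Uc' _ KE]]].
  have : size c <= #|vertices K|.
    by rewrite -(card_cycle_graph Uc) subset_leq_card //; apply/subsetP.
  by rewrite KE cards2; case: (_ != _); lia.
apply: contraT => yn.
have U3 : uniq [:: next c x; prev c x; y].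
  move: yn; rewrite /= !inE !negb_or next_neq_prev //= ![_ == y]eq_sym.
  by move=> /andP[-> ->].
have xc' : x \in c' by have := cK x xc; rewrite KE inE.
have /(uniq_leq_size U3)//: {subset [:: next c x; prev c x; y] <=
    [:: next c' x; prev c' x]}.
by move=> a /nK; rewrite KE -/(cycle_graph c') cycle_graph_edge.
Qed.

(** As [c] has no chord, the two neighbours of a vertex along [c'] are its two neighbours along [c].
    So [c'] is closed under [next c], and walking around [c] shows that it contains every vertex of
    [c]. *)
Lemma cactus_cycle_subset e c c' : simple_graph e -> cactus e ->
  uniq c -> uniq c' -> 2 < size c -> 2 < size c' ->
  subgraph_of e (cycle_graph c) -> subgraph_of e (cycle_graph c') ->
  {subset c' <= c} -> cycle_graph c' = cycle_graph c.
Proof.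
move=> es cact Uc Uc' c3 c3' ec ec' sub.
have cyc := cactus_cyclic_on es cact Uc c3 ec.
have cyc' := cactus_cyclic_on es cact Uc' c3' ec'.
have same x : x \in c' -> next c x \in [:: next c' x; prev c' x].
  move=> xc'; have xc := sub x xc'.
  have := cyc x (next c' x) xc; have := cyc x (prev c' x) xc.
  rewrite !sub ?mem_next ?mem_prev // !cyc' ?mem_next ?mem_prev //.
  rewrite !inE !eqxx orbT /=.
  move=> /(_ isT)/esym/orP[]/eqP Ep /(_ isT)/esym/orP[]/eqP En.
  - by have := next_neq_prev Uc' c3' xc'; rewrite Ep En eqxx.
  - by rewrite Ep eqxx orbT.
  - by rewrite En eqxx.
  - by have := next_neq_prev Uc' c3' xc'; rewrite Ep En eqxx.
have closed x : x \in c' -> next c x \in c'.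
  by move=> xc'; have := same x xc'; rewrite !inE => /orP[]/eqP->;
     rewrite ?mem_next ?mem_prev.
have [x0 x0c'] : exists x, x \in c' by case: (c') c3' => // x s _; exists x;
  rewrite mem_head.
have sub' : {subset c <= c'}.
  have [i s E] := rot_to (sub _ x0c') => x; rewrite -(mem_rot i) E.
  have := cycle_next Uc; rewrite -(rot_cycle i) E /= rcons_path => /andP[+ _].
  elim: s x0 x0c' {E} => [|y s IH] x1 x1c' /=; first by rewrite inE => _ /eqP->.
  case/andP=> /eqP yE ps; rewrite inE => /orP[/eqP->//|].
  by apply: IH; rewrite // -yE closed.
have cc' : c =i c' by move=> x; apply/idP/idP => [/sub'|/sub].
congr pair; first by apply/setP => x; rewrite !inE cc'.
apply/setP => f; apply/imsetP/imsetP => -[x xc ->].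
  apply/imsetP; rewrite -[X in is_true X]/(_ \in edges (cycle_graph c)).
  by rewrite cycle_graph_edge ?sub // -cyc ?sub ?mem_next // cyc' ?mem_next //
    mem_head.
apply/imsetP; rewrite -[X in is_true X]/(_ \in edges (cycle_graph c')).
by rewrite cycle_graph_edge ?sub' // same ?sub'.
Qed.

End Cacti.

(** * The graph with the shifted edge *)

Lemma eq_set2 (T : finType) (x y a b : T) :
  ([set x; y] == [set a; b]) = (x == a) && (y == b) || (x == b) && (y == a).
Proof.
apply/eqP/orP => [/set2_inj[][-> ->]|[]/andP[/eqP-> /eqP->]//].
- by left; rewrite !eqxx.
- by right; rewrite !eqxx.
by rewrite setUC.
Qed.

(** Reversal, if needed, makes [v] the successor of [u]; then [w], being a neighbour of [v] other
    than [u], is the successor of [v], and a rotation puts [u] first. *)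
Lemma cyclic_orientation (T : finType) (e : rel T) (c : seq T) (u v w : T) :
  uniq c -> cyclic_on e c -> u \in c -> v \in c -> w \in c ->
  e u v -> e v w -> w != u ->
  exists s, [/\ uniq [:: u, v, w & s], [:: u, v, w & s] =i c &
                cyclic_on e [:: u, v, w & s]].
Proof.
move=> Uc cyc uc vc wc euv evw wu.
wlog nu : c Uc cyc uc vc wc / next c u = v.
  move=> IH; have := euv; rewrite cyc // !inE => /orP[]/eqP vE.
    exact: (IH c).
  have [||||||s [Us sE cycs]] := IH (rev c);
    rewrite ?rev_uniq ?mem_rev ?next_rev //; first exact: cyclic_on_rev.
  by exists s; split=> // x; rewrite sE mem_rev.
have nv : next c v = w.
  have := evw; rewrite cyc // !inE => /orP[]/eqP // wE.
  by rewrite wE -nu prev_next // eqxx in wu.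
have [i s E] := rot_to uc.
have := nu; have := nv; rewrite -!(next_rot i Uc).
have memr := mem_rot i c; have cycr := cyclic_on_rot (i := i) Uc cyc.
have Ur : uniq (rot i c) by rewrite rot_uniq.
rewrite -memr in wc; move: memr cycr Ur wc; rewrite {}E.
case: s => [|v' [|w' s]] memr cycr Ur wc.
- by rewrite inE (negPf wu) in wc.
- move: Ur wc; rewrite /= !inE (negPf wu) eqxx andbT => uv' /eqP->.
  move=> nvE vE; move: nvE uv'; rewrite -vE eq_sym => + /negPf uv'.
  by rewrite uv' eqxx => uE; rewrite uE eqxx in uv'.
rewrite /= eqxx => + vE; move: Ur memr cycr; rewrite -{}vE => Ur memr cycr.
move: (Ur); rewrite /= inE negb_or eq_sym => /and3P[/andP[/negPf-> _] _ _].
by rewrite eqxx => wE; exists s; rewrite -wE.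
Qed.

Section ShiftEdge.
Variables (T : finType) (e : rel T) (u v w : T) (s : seq T).
Local Notation c := [:: u, v, w & s].
Local Notation c' := [:: u, w & s].
Local Notation e' := (shift_edge e u v w).
Hypotheses (esym : symmetric e) (eirr : irreflexive e).
Hypotheses (econn : forall x y, connect e x y).
Hypotheses (Uc : uniq c) (cyc : cyclic_on e c).
Hypothesis att : attached_at e [set z in c] u.

Lemma shift_edgeE x y : e' x y =
  e x y && ~~ ((x == v) && (y == w) || (x == w) && (y == v))
  || ((x == u) && (y == w) || (x == w) && (y == u)).
Proof. by rewrite /shift_edge !eq_set2. Qed.

Lemma shift_edge_sym : symmetric e'.
Proof. by move=> x y; rewrite /shift_edge esym ![[set y; x]]setUC. Qed.

Let neqs : [/\ u != v, u != w & v != w].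
Proof.
move: Uc; rewrite /= !inE !negb_or => /and3P[/and3P[uv uw _] /andP[vw _] _].
by split.
Qed.

Lemma shift_edge_irr : irreflexive e'.
Proof.
have [_ uw _] := neqs; move=> x; rewrite shift_edgeE eirr /=.
by have [->|] := eqVneq x u; rewrite ?(negPf uw) ?andbF.
Qed.

Let edge_uv : e u v.
Proof.
by rewrite cyc ?inE ?eqxx ?orbT //= !eqxx.
Qed.

(** The deleted edge is replaced by the detour from [v] through [u] to [w]. *)
Lemma shift_edge_connect x y : connect e' x y.
Proof.
have [uv uw vw] := neqs.
have csym : connect_sym e' by apply/sym_connect_sym/shift_edge_sym.
have vw' : connect e' v w.
  apply: (@connect_trans _ _ u); last first.
    by apply: connect1; rewrite shift_edgeE !eqxx orbT.
  rewrite csym; apply: connect1; rewrite shift_edgeE edge_uv.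
  by rewrite (negPf uv) (negPf uw).
have := econn x y; apply: connect_sub => a b eab.
have [/andP[/eqP-> /eqP->]//|n1] := boolP ((a == v) && (b == w)).
have [/andP[/eqP-> /eqP->]|n2] := boolP ((a == w) && (b == v)).
  by rewrite csym.
by apply: connect1; rewrite shift_edgeE eab (negPf n1) (negPf n2).
Qed.

Lemma shift_edge_attached : attached_at e' [set z in c] u.
Proof.
split=> [|x y]; first by rewrite !inE eqxx.
move=> xc yc; have := yc; rewrite shift_edgeE !inE !negb_or.
case/and4P=> /negPf-> /negPf-> /negPf-> _; rewrite !andbF !orbF andbT.
exact: att.2.
Qed.

Lemma shift_edge_far_side : {in far_side [set z in c] u &, e =2 e'}.
Proof.
have [_ uw _] := neqs.
have nw x : x \in far_side [set z in c] u -> x == w = false.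
  rewrite !inE !negb_or => /orP[/eqP->|/and4P[_ _ /negPf-> _]//].
  exact: negPf.
by move=> x y /nw xw /nw yw; rewrite shift_edgeE xw yw !andbF !orbF andbT.
Qed.

Let Uc' : uniq c'.
Proof.
by move: Uc; rewrite /= !inE !negb_or => /and4P[/and3P[_ -> ->] _ -> ->].
Qed.

Let vc' : v \notin c'.
Proof.
have [uv _ _] := neqs; rewrite inE eq_sym negb_or uv.
by move: Uc => /= /and3P[].
Qed.

Lemma shift_edge_cyclic_on : cyclic_on e' c'.
Proof.
have [uv uw vw] := neqs.
move=> x y xc' yc'; have sub z : z \in c' -> z \in c.
  by rewrite !inE => /or3P[]->; rewrite ?orbT.
have nv z : z \in c' -> z == v = false.
  by move=> zc'; apply: contraNF vc' => /eqP<-.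
(* Predecessors are rewritten as successors, which compute on the explicit lists [c] and [c']. *)
have prevE (r : seq T) z t : uniq r -> (t == prev r z) = (next r t == z).
  move=> Ur; apply/eqP/eqP => [->|<-]; first exact: next_prev.
  by rewrite prev_next.
rewrite shift_edgeE cyc ?sub // !inE !prevE // !(nv x xc') !(nv y yc').
rewrite !andbF /= !(nv x xc') !(nv y yc') andbT.
have [->|xu] := eqVneq x u; have [->|yu] := eqVneq y u;
  rewrite ?eqxx ?(eq_sym v) ?(eq_sym w) ?(negPf uv) ?(negPf uw) ?(nv y yc')
    ?(nv x xc') ?andbF ?andbT ?orbF //=.
by rewrite orbC.
Qed.

Lemma shift_edge_leaf : e' v =1 pred1 u.
Proof.
have [uv uw vw] := neqs; have vc : v \in c by rewrite !inE eqxx orbT.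
move=> y; rewrite shift_edgeE eqxx (eq_sym v u) (negPf uv) (negPf vw) /= !orbF.
have [yc|yc] := boolP (y \in c); last first.
  have -> : e v y = false.
    apply: contraNF uv => evy.
    by rewrite -(att.2 v y) ?inE ?eqxx ?orbT // inE.
  by symmetry; apply: contraNF yc => /eqP->; rewrite mem_head.
have pv : prev c v = u.
  by rewrite -[RHS](prev_next Uc) /= !eqxx.
have nv : next c v = w by rewrite /= eq_sym (negPf uv) eqxx.
rewrite cyc // [y \in _]inE nv inE pv.
by have [->|] := eqVneq y w; rewrite ?andbT // ?(eq_sym w) (negPf uw).
Qed.

(** Since [v] is now a leaf at [u], it may be counted as outside, and the formulas for cycles apply
    to [c'] alone. *)
Lemma shift_edge_attached_cycle : attached_at e' [set z in c'] u.
Proof.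
split=> [|x y]; first by rewrite !inE eqxx.
have sub z : z \in c = (z == v) || (z \in c').
  by rewrite !inE; do !case: (_ == _).
rewrite !(inE, in_set) => xc yc exy.
have [yv|yv] := eqVneq y v.
  by move: exy; rewrite yv shift_edge_sym shift_edge_leaf => /eqP.
apply: (shift_edge_attached.2 x y) => //; rewrite inE sub.
  by rewrite !inE xc orbT.
by rewrite (negPf yv) !inE.
Qed.

Hypothesis s0 : s != [::].

Let c'3 : 2 < size c'. Proof. by case: (s) s0. Qed.

Lemma shift_edge_degree_in x : x \in c' ->
  degree_in e' [set z in c] x = (2 + (x == u))%N.
Proof.
move=> xc'; rewrite -(degree_in_cyclic Uc' c'3 shift_edge_cyclic_on xc').
have exv : e' x v = (x == u) by rewrite shift_edge_sym shift_edge_leaf.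
rewrite /degree_in [LHS](cardsD1 v) !inE !eqxx orbT exv addnC.
congr addn; apply: eq_card => y; rewrite !inE.
have [->|yv] := eqVneq y v; last by [].
by rewrite /= -in_cons -in_cons (negPf vc').
Qed.

Lemma shift_edge_degree_in_leaf : degree_in e' [set z in c] v = 1%N.
Proof.
rewrite /degree_in -(cards1 u); apply: eq_card => y; rewrite !inE.
by rewrite shift_edge_leaf /=; case: eqP; rewrite ?andbT ?andbF.
Qed.

(** * The exact difference of the two values of D_R *)

Section Comparison.
Variable R : realType.
Local Open Scope ring_scope.
Local Notation S := [set z in c].
Local Notation k := ((size c')%:R : R).
Local Notation rest := (\sum_(y in ~: S) resistance R e u y).

Let c3 : (2 < size c)%N. Proof. by []. Qed.

Let sum_c (F : T -> R) :
  \sum_(x in S) F x = F v + \sum_(x in [set z in c']) F x.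
Proof.
rewrite -big_setU1; last by rewrite in_set.
by apply: eq_bigl => x; rewrite !inE; do !case: (_ == _).
Qed.

Let att' := shift_edge_attached.
Let P' x : x \in c' -> \sum_(y in [set z in c']) resistance R e' x y =
  (k ^+ 2 - 1) / 6%:R.
Proof.
exact: cycle_resistance_sum shift_edge_sym shift_edge_connect Uc' c'3
  shift_edge_cyclic_on shift_edge_attached_cycle.
Qed.
Let kE : (size c)%:R = k + 1. Proof. by rewrite natr1. Qed.

(** All k + 1 vertices have degree 2 within the cycle and the same resistance sum. *)
Let side_e : side_contribution R e S u =
  ((k + 1) ^+ 2 - 1) / 6%:R * (2%:R * (k + 1) + 2%:R * #|~: S|%:R) +
  2%:R * (k + 1) * rest.
Proof.
have P x : x \in S -> \sum_(y in S) resistance R e x y =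
    ((k + 1) ^+ 2 - 1) / 6%:R.
  by rewrite in_set -kE; apply: cycle_resistance_sum esym econn Uc c3 cyc att.
have d2 x : x \in S -> degree_in e S x = 2%N.
  by rewrite in_set; apply: degree_in_cyclic.
have cS : #|S|%:R = k + 1 by rewrite cardsE (card_uniqP Uc).
have E1 : \sum_(x in S) (degree_in e S x)%:R * \sum_(y in S) resistance R e x y
    = (k + 1) * (2%:R * (((k + 1) ^+ 2 - 1) / 6%:R)).
  rewrite -[X in _ = X * _]cS mulr_natl -sumr_const.
  by apply: eq_bigr => x xS; rewrite d2 // P.
have E2 : \sum_(x in S) (degree_in e S x)%:R * resistance R e u x
    = 2%:R * (((k + 1) ^+ 2 - 1) / 6%:R).
  rewrite -(P u) ?in_set ?mem_head // mulr_sumr.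
  by apply: eq_bigr => x xS; rewrite d2.
have E3 : \sum_(x in S) (degree_in e S x)%:R = (k + 1) * 2%:R :> R.
  by rewrite -cS mulr_natl -sumr_const; apply: eq_bigr => x xS; rewrite d2.
by rewrite /side_contribution E1 E2 E3; ring.
Qed.

Let r_leaf : resistance R e' v u = 1.
Proof.
have [uv _ _] := neqs.
exact: resistance_adjacent_leaf shift_edge_sym shift_edge_connect
  shift_edge_leaf uv.
Qed.

Let r_leaf_cycle x : x \in c' ->
  resistance R e' x v = resistance R e' u x + 1.
Proof.
move=> xc'; have sym := resistance_sym R _ _ shift_edge_sym shift_edge_connect.
rewrite (resistance_across R shift_edge_sym shift_edge_connect
  shift_edge_attached_cycle) ?in_set //.
by rewrite (sym x u) (sym u v) r_leaf.
Qed.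

Let sum_S' : \sum_(y in S) resistance R e' u y = (k ^+ 2 - 1) / 6%:R + 1.
Proof.
by rewrite sum_c P' ?mem_head // r_leaf_cycle ?mem_head // resistancexx; ring.
Qed.

(** Let p = (k^2 - 1) / 6. Within this side the resistances sum to p + k from the leaf and to p +
    R(u,x) + 1 from a cycle vertex x. The degrees are 1 at [v], 3 at [u] and 2 elsewhere; their
    total 2 (k + 1) is the one before the shift, so the resistances from [u] to the outside will
    cancel. *)
Let side_e' : side_contribution R e' S u =
  (k ^+ 2 - 1) / 6%:R * (2%:R * k + 4%:R) + 3%:R * k + 1 +
  #|~: S|%:R * (2%:R * ((k ^+ 2 - 1) / 6%:R) + 1) +
  2%:R * (k + 1) * \sum_(y in ~: S) resistance R e' u y.
Proof.
have cS' : #|[set z in c']|%:R = k by rewrite cardsE (card_uniqP Uc').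
have d3 x : x \in [set z in c'] ->
    (degree_in e' S x)%:R = 2%:R + (x == u)%:R :> R.
  by rewrite in_set => xc'; rewrite shift_edge_degree_in // natrD.
have sum_u (F : T -> R) : \sum_(x in [set z in c']) (x == u)%:R * F x = F u.
  rewrite (bigD1 u) ?in_set ?mem_head //= eqxx mul1r big1 ?addr0 //.
  by move=> x /andP[_ /negPf->]; rewrite mul0r.
pose p : R := (k ^+ 2 - 1) / 6%:R.
have E1 : \sum_(x in S) (degree_in e' S x)%:R *
      \sum_(y in S) resistance R e' x y = p * (2%:R * k + 4%:R) + 3%:R * k + 1.
  rewrite sum_c shift_edge_degree_in_leaf mul1r sum_c resistancexx add0r.
  have -> : \sum_(x in [set z in c']) resistance R e' v x = p + k.
    rewrite /p -(P' (mem_head u (w :: s))) -cS' -sumr_const -big_split.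
    apply: eq_bigr => x /=; rewrite in_set => /r_leaf_cycle <-.
    exact: resistance_sym shift_edge_sym shift_edge_connect.
  rewrite (eq_bigr (fun x => 2%:R * resistance R e' u x + 2%:R * (1 + p) +
      (x == u)%:R * (resistance R e' u x + 1 + p))); last first.
    move=> x xS; rewrite d3 // sum_c; move: xS; rewrite in_set => xc'.
    by rewrite r_leaf_cycle // P' // -/p; ring.
  rewrite !big_split /= sum_u resistancexx -mulr_sumr P' ?mem_head // -/p.
  rewrite sumr_const -[_ *+ #|_|]mulr_natr cS'.
  by rewrite -[(size s).+2]/(size c'); ring.
have E2 : \sum_(x in S) (degree_in e' S x)%:R * resistance R e' u x
    = 2%:R * p + 1.
  rewrite sum_c shift_edge_degree_in_leaf mul1r r_leaf_cycle ?mem_head //.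
  rewrite resistancexx (eq_bigr (fun x => 2%:R * resistance R e' u x +
      (x == u)%:R * resistance R e' u x)); last first.
    by move=> x xS; rewrite d3 // mulrDl.
  rewrite big_split /= sum_u resistancexx -mulr_sumr P' ?mem_head // -/p.
  by ring.
have E3 : \sum_(x in S) (degree_in e' S x)%:R = 2%:R * (k + 1) :> R.
  rewrite sum_c shift_edge_degree_in_leaf (eq_bigr (fun x => 2%:R +
    (x == u)%:R * 1)); last by move=> x xS; rewrite d3 // mulr1.
  rewrite big_split /= sum_u sumr_const -[_ *+ #|_|]mulr_natr cS'.
  by rewrite -[(size s).+2]/(size c'); ring.
by rewrite /side_contribution E1 E2 E3.
Qed.

Let far : {set T} := far_side S u.

Let sum_not_far (F : T -> R) : F u = 0 ->
  \sum_(y in ~: far) F y = \sum_(y in S) F y.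
Proof.
move=> Fu; rewrite [RHS](bigD1 u) ?in_set ?mem_head //= Fu add0r.
by apply: eq_bigl => y; rewrite in_setC in_setU1 in_setC negb_or negbK andbC.
Qed.

(** On the far side degrees and resistances are unchanged. Only the sum of resistances from [u] into
    the cycle side drops, by ((k + 1)^2 - k^2) / 6 - 1 = (2 k - 5) / 6, and it is weighted by the
    degree sum of the far side, that is 2 q. *)
Lemma degree_resistance_distance_shift_edge :
  degree_resistance_distance R e - degree_resistance_distance R e' =
  (k ^+ 2 - 6%:R * k - 1 + #|~: S|%:R * (2%:R * k - 2%:R) +
   (\sum_(x in far) degree_in e far x)%:R / 2%:R * (2%:R * k - 5%:R)) / 3%:R.
Proof.
have eqf := shift_edge_far_side.
have attf := attached_far_side esym att.
have attf' := attached_far_side shift_edge_sym att'.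
have r x y : x \in far -> y \in far -> resistance R e' x y = resistance R e x y.
  by move=> xf yf; rewrite (eq_resistance_induced R esym shift_edge_sym econn
    shift_edge_connect attf attf' eqf).
have d x : x \in far -> degree_in e' far x = degree_in e far x.
  move=> xf; apply: eq_card => y; rewrite [LHS]in_set [RHS]in_set.
  by case yf: (y \in far); rewrite //= eqf.
have uf : u \in far by rewrite !inE eqxx.
have F : \sum_(y in ~: S) resistance R e' u y = rest.
  by apply: eq_bigr => y yS; rewrite r // in_setU1 yS orbT.
rewrite (degree_resistance_distance_glue R esym eirr econn att).
rewrite (degree_resistance_distance_glue R shift_edge_sym shift_edge_irr
  shift_edge_connect att').
rewrite side_e side_e' F /side_contribution -/far.
rewrite !sum_not_far ?resistancexx // sum_S'.
rewrite (cycle_resistance_sum R esym econn Uc c3 cyc att) ?mem_head // kE.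
have -> : \sum_(x in far) (degree_in e' far x)%:R *
      (\sum_(y in far) resistance R e' x y) =
    \sum_(x in far) (degree_in e far x)%:R *
      (\sum_(y in far) resistance R e x y).
  apply: eq_bigr => x xf; rewrite d //; congr (_ * _).
  by apply: eq_bigr => y yf; rewrite r.
have -> : \sum_(x in far) (degree_in e' far x)%:R * resistance R e' u x =
    \sum_(x in far) (degree_in e far x)%:R * resistance R e u x.
  by apply: eq_bigr => x xf; rewrite d // r.
have -> : \sum_(x in far) (degree_in e' far x)%:R =
    \sum_(x in far) (degree_in e far x)%:R :> R.
  by apply: eq_bigr => x xf; rewrite d.
by rewrite natr_sum; field.
Qed.

End Comparison.
End ShiftEdge.

(** * The part of the graph outside the cycle *)

(** A neighbour along [c] of a vertex off [S] is again off [S] unless it is [u]. So [y] has a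
    companion [z] off [S], and if there is no third such vertex then [u], [y], [z] form a triangle,
    whose degrees add up to 6. *)
Lemma far_side_size (T : finType) (e : rel T) (S : {set T}) (u : T)
    (c : seq T) (y : T) :
  symmetric e -> irreflexive e -> attached_at e S u ->
  uniq c -> 2 < size c -> cyclic_on e c -> y \in c -> y \notin S ->
  3 <= #|~: S| \/
  2 <= #|~: S| /\ 6 <= \sum_(x in far_side S u) degree_in e (far_side S u) x.
Proof.
move=> esym eirr att Uc c3 cyc yc yS.
have [|le2] := leqP 3 #|~: S|; [by left | right].
have nbr x t : x \in c -> t \in [:: next c x; prev c x] -> e x t.
  move=> xc tn; rewrite cyc //.
  by move: tn; rewrite !inE => /orP[]/eqP->; rewrite ?mem_next ?mem_prev.
have out x t : x \notin S -> e x t -> t != u -> t \notin S.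
  move=> xS; rewrite esym => etx; apply: contraNN => tS.
  by rewrite (att.2 _ _ tS xS etx).
have two x : x \in c -> x \notin S -> exists2 z, z \notin S & z \in c /\ e x z.
  move=> xc xS; have np := next_neq_prev Uc c3 xc.
  have [nu|nu] := eqVneq (next c x) u.
    exists (prev c x); last by rewrite mem_prev nbr ?inE ?eqxx ?orbT.
    by apply: (out x); rewrite // ?nbr ?inE ?eqxx ?orbT // -nu eq_sym.
  exists (next c x); last by rewrite mem_next nbr ?inE ?eqxx.
  by apply: (out x); rewrite // nbr ?inE ?eqxx.
have [z zS [zc eyz]] := two y yc yS.
have yz : y != z by apply: contraTneq eyz => ->; rewrite eirr.
have SE : ~: S = [set y; z].
  symmetry; apply/eqP; rewrite eqEcard cards2 yz -ltnS le2 andbT.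
  by apply/subsetP => t; rewrite !inE => /orP[]/eqP->.
(* Only one other vertex is left off [S], so one of the two neighbours along [c] has to be [u]. *)
have to_u x : x \in c -> x \notin S -> e x u.
  move=> xc xS; apply: contraT => nxu.
  have sub : {subset [:: next c x; prev c x] <= ~: S :\ x}.
    move=> t tn; have ext := nbr x t xc tn.
    rewrite in_setD1 in_setC (out x t) // ?andbT.
      by apply: contraTneq ext => ->; rewrite eirr.
    by apply: contraNneq nxu => <-.
  have := next_neq_prev Uc c3 xc.
  have : #|~: S :\ x| <= 1 by move: le2; rewrite (cardsD1 x (~: S)) in_setC xS.
  move/card_le1_eqP => E.
  by rewrite (E (next c x) (prev c x)) ?eqxx ?sub ?inE ?eqxx ?orbT.
have eyu := to_u y yc yS; have ezu := to_u z zc zS.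
split; first by rewrite SE cards2 yz.
have uS := att.1.
have uy : u != y by apply: contraNneq yS => <-.
have uz : u != z by apply: contraNneq zS => <-.
have deg x a b : a != b -> a \in far_side S u -> b \in far_side S u ->
    e x a -> e x b -> 2 <= degree_in e (far_side S u) x.
  move=> ab af bf ea eb; have <- : #|[set a; b]| = 2 by rewrite cards2 ab.
  apply: subset_leq_card; apply/subsetP => t; rewrite in_set2 in_set.
  by case/orP => /eqP->; rewrite ?af ?bf.
have uf : u \in far_side S u by rewrite in_setU1 eqxx.
have yf : y \in far_side S u by rewrite in_setU1 in_setC yS orbT.
have zf : z \in far_side S u by rewrite in_setU1 in_setC zS orbT.
have du : 2 <= degree_in e (far_side S u) u.
  by apply: (deg u y z); rewrite // esym.
have dy : 2 <= degree_in e (far_side S u) y.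
  by apply: (deg y z u); rewrite // eq_sym.
have dz : 2 <= degree_in e (far_side S u) z.
  by apply: (deg z y u); rewrite // 1?esym // eq_sym.
rewrite (bigD1 u) //= (bigD1 y) /=; last by rewrite yf eq_sym.
rewrite (bigD1 z) /=; last by rewrite zf ![z == _]eq_sym uz.
exact: (@leq_add 2 4) du (@leq_add 2 2 _ _ dy (leq_trans dz (leq_addr _ _))).
Qed.

(** * The strict inequality *)

Theorem mainTheorem3 (R : realType) (T : finType) (n t h : nat) (e : rel T)
    (e_simple : simple_graph e) (e_cact : Cact n t e) (t_ge3 : 3 <= t)
    (C : subgraph T) (C_cycle : C \in cycles e)
    (C_size : #|vertices C| = h) (h_ge4 : 4 <= h)
    (u : T) (u_in_C : u \in vertices C)
    (u_out : exists2 y, y \notin vertices C & e u y)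
    (u_unique : forall x y, x \in vertices C -> y \notin vertices C ->
       e x y -> x = u)
    (v w : T) (v_in_C : v \in vertices C) (w_in_C : w \in vertices C)
    (uv_edge : [set u; v] \in edges C)
    (vw_edge : [set v; w] \in edges C) (w_neq_u : w != u) :
  (degree_resistance_distance R e >
   degree_resistance_distance R (shift_edge e u v w))%R.
Proof.
have [esym eirr] := e_simple; have [_ cact card_t] := e_cact.
have econn x y : connect e x y.
  have [_ /(_ x y)] := cact.1; rewrite !inE => /(_ isT isT).
  by apply: connect_sub => a b; rewrite whole_edge // => /connect1.
have : C \in cycles e := C_cycle.
rewrite inE => /andP[eC /asboolP[c [Uc c3 CE]]].
rewrite -/(cycle_graph c) in CE; rewrite CE in eC.
have cyc := cactus_cyclic_on e_simple cact Uc c3 eC.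
have inC x : (x \in vertices C) = (x \in c) by rewrite CE inE.
have /andP[/andP[_ /subsetP sE] _] := eC.
have edgeC x y : [set x; y] \in edges C -> e x y.
  by rewrite CE => /sE; rewrite whole_edge.
rewrite !inC in u_in_C v_in_C w_in_C.
have [s [Us sc cycs]] := cyclic_orientation Uc cyc u_in_C v_in_C w_in_C
  (edgeC _ _ uv_edge) (edgeC _ _ vw_edge) w_neq_u.
set S := [set z in [:: u, v, w & s]].
have SC : S = vertices C by apply/setP => x; rewrite inC in_set sc.
have att : attached_at e S u.
  by split=> [|x y]; rewrite ?SC ?inC //; rewrite -!inC; apply: u_unique.
have sz : (size s).+3 = h.
  by rewrite -C_size -SC cardsE (card_uniqP Us).
have s0 : s != [::] by move: h_ge4; rewrite -sz; case: (s).
(* The bound on [t] supplies a cycle other than [C]. *)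
have [C' C'in C'C] : exists2 C', C' \in cycles e & C' != C.
  have /card_gt0P[C'] : 0 < #|cycles e :\ C|.
    by move: t_ge3; rewrite -card_t (cardsD1 C) C_cycle add1n ltnS => /ltnW.
  by rewrite in_setD1 => /andP[]; exists C'.
move: C'in; rewrite inE => /andP[eC' /asboolP[c' [Uc' c3' C'E]]].
rewrite -/(cycle_graph c') in C'E; rewrite C'E in eC' C'C.
(* A cycle with all its vertices on [C] would be [C] itself. *)
have [y yc' yS] : exists2 y, y \in c' & y \notin S.
  apply/exists_inP; apply: contraR C'C.
  rewrite negb_exists_in => /forall_inP sub.
  rewrite CE; apply/eqP/(cactus_cycle_subset e_simple cact) => // x /sub.
  by rewrite negbK SC inC.
have cyc' := cactus_cyclic_on e_simple cact Uc' c3' eC'.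
have far := far_side_size esym eirr att Uc' c3' cyc' yc' yS.
rewrite -subr_gt0 (degree_resistance_distance_shift_edge esym eirr econn Us cycs
  att s0) divr_gt0 // -/S.
(* Here k = h - 1, so h >= 4 gives k >= 3. *)
have k3 : (3%:R <= (size [:: u, w & s])%:R :> R)%R.
  by rewrite ler_nat; case: (s) s0.
move: far k3; move: (size _) => k; move: #|_| => M.
move: (\sum_(x in _) _) => Q [M3 | [M2 Q6]] k3.
  (* The numerator is greater than k^2 - 7 in the first case and at least k^2 + 4 k - 20 in the
     second, with q = Q / 2; both bounds are positive from k = 3 on, and the second equals 1 at k =
     3. *)
  have {}M3 : (3%:R <= M%:R :> R)%R by rewrite ler_nat.
  have Q0 : (0 <= Q%:R :> R)%R by [].
  nra.
have {}M2 : (2%:R <= M%:R :> R)%R by rewrite ler_nat.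
have {}Q6 : (6%:R <= Q%:R :> R)%R by rewrite ler_nat.
nra.
Qed.
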